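(* Let $N=N(\iota)$ be an increasing sequence and, for each $\iota$, let $\bm A,\bm B\in\mathbb{C}^{N\times N}$ be random orthogonal projection matrices with $\frac1N\operatorname{Tr}(\bm A)\to\alpha\in(0,1)$ and $\frac1N\operatorname{Tr}(\bm B)\to\beta\in(0,1)$ in probability as $\iota\to\infty$. Suppose that $\alpha=\frac12$ or $\beta=\frac12$, that the empirical spectral distribution of $\bm A\bm B\bm A$ converges in probability to $\mathsf{MANOVA}(\alpha,\beta)$, and that there is a sequence of integers $k=k(\iota)$ with $\log N=o(k)$ such that $$\max_{1\le a\le k}\left|\mathbb{E}\operatorname{Tr}\left(\Big(\frac{\bm A-\alpha\bm I_N}{\sqrt{\alpha(1-\alpha)}}\cdot\frac{\bm B-\beta\bm I_N}{\sqrt{\beta(1-\beta)}}\Big)^a\right)\right|\le\exp(o(k)).$$ Then $\lambda_{\max}(\bm A\bm B\bm A)=\|\bm A\bm B\|^2$ converges in probability to $\mathsf{edge}(\alpha,\beta)$.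
   Context: For $\alpha,\beta\in(0,1)$, $\mathsf{MANOVA}(\alpha,\beta)$ is the probability measure on $\mathbb{R}$ $$d\mu(x)=\frac{\sqrt{(r_+-x)(x-r_-)}}{2\pi x(1-x)}\mathbf 1_{[r_-,r_+]}(x)\,dx+(1-\min\{\alpha,\beta\})\delta_0+\max\{\alpha+\beta-1,0\}\delta_1,$$ where $r_\pm=r_\pm(\alpha,\beta)=\big(\sqrt{\alpha(1-\beta)}\pm\sqrt{\beta(1-\alpha)}\big)^2$ and $\delta_c$ is the Dirac mass at $c$. $\mathsf{edge}(\alpha,\beta)=1$ if $\alpha+\beta>1$ and $\mathsf{edge}(\alpha,\beta)=r_+(\alpha,\beta)$ if $\alpha+\beta\le1$. The empirical spectral distribution of a Hermitian $N\times N$ matrix with eigenvalues $\lambda_i$ is $\frac1N\sum_i\delta_{\lambda_i}$; random measures $\mu_\iota$ converge in probability to $\mu$ if $\int f d\mu_\iota\to\int f d\mu$ in probability for every continuous compactly supported $f$. ''$\le\exp(o(k))$'' means bounded by $\exp(\varepsilon_\iota k(\iota))$ for some sequence $\varepsilon_\iota\to0$. $\lambda_{\max}$ is the largest eigenvalue and $\|\cdot\|$ the operator norm. *)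

(* Defs.v *)
From HB Require Import structures.
From mathcomp Require Import all_boot all_order all_algebra.
From mathcomp Require Import complex.
From mathcomp Require Import all_classical all_reals all_analysis.

Set Implicit Arguments.
Unset Strict Implicit.
Unset Printing Implicit Defensive.

Import Order.TTheory GRing.Theory Num.Theory.
Import numFieldNormedType.Exports.
Local Open Scope classical_set_scope.
Local Open Scope ring_scope.

Section Defs.
Variable R : realType.

Definition ctrmx n (M : 'M[R[i]]_n) : 'M[R[i]]_n := map_mx (@conjc R) M^T.

Definition is_orth_proj n (M : 'M[R[i]]_n) : Prop :=
  ctrmx M = M /\ M *m M = M.

(* the eigenvalues of M, listed with algebraic multiplicity
   (roots of the characteristic polynomial) *)
Definition eigs n (M : 'M[R[i]]_n) : seq R[i] :=
  sval (closed_field_poly_normal (char_poly M)).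

(* integral of f against the empirical spectral distribution of a Hermitian
   matrix M (whose eigenvalues are real):  (1/n) sum_i f(lambda_i) *)
Definition esd_int n (M : 'M[R[i]]_n) (f : R -> R) : R :=
  (n%:R)^-1 * \sum_(z <- eigs M) f (complex.Re z).

(* largest eigenvalue of a Hermitian matrix (0 for the empty matrix) *)
Definition lambda_max n (M : 'M[R[i]]_n) : R :=
  \big[Num.max/head 0 [seq complex.Re z | z <- eigs M]]_(z <- eigs M) complex.Re z.

Definition csqnorm (z : R[i]) : R := complex.Re z ^+ 2 + complex.Im z ^+ 2.
Definition vnorm n (v : 'cV[R[i]]_n) : R :=
  Num.sqrt (\sum_(j < n) csqnorm (v j 0)).
Definition opnorm n (M : 'M[R[i]]_n) : R :=
  sup [set vnorm (M *m v) | v in [set v : 'cV[R[i]]_n | vnorm v = 1]].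

Definition r_minus (a b : R) : R :=
  (Num.sqrt (a * (1 - b)) - Num.sqrt (b * (1 - a))) ^+ 2.
Definition r_plus (a b : R) : R :=
  (Num.sqrt (a * (1 - b)) + Num.sqrt (b * (1 - a))) ^+ 2.
Definition manova_density (a b x : R) : R :=
  Num.sqrt ((r_plus a b - x) * (x - r_minus a b)) / (2 * pi * x * (1 - x)).

Definition manova_int (a b : R) (f : R -> R) : R :=
  Rintegral lebesgue_measure `[r_minus a b, r_plus a b]
      (fun x => f x * manova_density a b x)
  + (1 - Num.min a b) * f 0
  + Num.max (a + b - 1) 0 * f 1.

Definition edge (a b : R) : R := if 1 < a + b then 1 else r_plus a b.

Definition cvg_in_prob (d : measure_display) (T : nat -> measurableType d)
  (P : forall i, probability (T i) R) (X : forall i, T i -> R) (c : R) : Prop :=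
  forall eps : R, 0 < eps ->
    (fun i => P i [set w | eps <= `|X i w - c|]) @ \oo --> 0%E.

Definition cexpect (d : measure_display) (T : measurableType d)
  (P : probability T R) (X : T -> R[i]) : R[i] :=
  (Rintegral P setT (fun w => complex.Re (X w)) +i* Rintegral P setT (fun w => complex.Im (X w)))%C.

Definition normalize n (a : R) (M : 'M[R[i]]_n) : 'M[R[i]]_n :=
  ((Num.sqrt (a * (1 - a)))^-1)%:C%C *: (M - ((a%:C)%C)%:M).

End Defs.

(* Main.v *)
(** Let [W] be the product of the normalized projections.  Each factor satisfies a
    quadratic equation, so [W] is invertible, and [W + W^-1] is an affine function of
    [(A - B)^2], hence Hermitian; every eigenvalue of [W] is therefore real or of
    modulus 1, and even powers of [W] satisfy [Re tr W^(2m) >= - N].  When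
    [alpha + beta <= 1], an eigenvalue of [A B A] above [r_plus + eps] forces a real
    eigenvalue of [W] that is at least some fixed [rho > 1], which improves this bound to
    [rho^(2m) - N].  Taking expectations with [2m] close to [k], and using
    [log N = o(k)], bounds the probability of such an outlier by [O(1/N)].
    Conversely, the limiting measure charges every neighbourhood of the edge, so its
    high moments exceed those of any measure carried by [[0, edge - eps]]. *)

Require Import Defs.
From HB Require Import structures.
From mathcomp Require Import all_boot all_order all_algebra.
From mathcomp Require Import complex.
From mathcomp Require Import all_classical all_reals all_analysis.
From mathcomp Require Import measurable_realfun ring lra.

Set Implicit Arguments.
Unset Strict Implicit.
Unset Printing Implicit Defensive.

Import Order.TTheory GRing.Theory Num.Theory.
Import numFieldNormedType.Exports.
Local Open Scope classical_set_scope.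
Local Open Scope ring_scope.

(** * Hermitian matrices and spectra *)

Section Hermitian.
Local Open Scope sesquilinear_scope.
Variable C : numClosedFieldType.
Local Notation dot := (@dotmx C _).

Lemma dotmx_mulmx n (x y : 'rV[C]_n) (M : 'M[C]_n) :
  dot (x *m M) y = dot x (y *m M ^t*).
Proof. by rewrite !dotmxE trmx_mul map_mxM trmxCK mulmxA. Qed.

Lemma hermitian_eig_real n (M : 'M[C]_n) (x : 'rV_n) a :
  M ^t* = M -> x != 0 -> x *m M = a *: x -> a^* = a.
Proof.
move=> Mh x0 xM; have x2 : dot x x != 0 by rewrite dnorm_eq0.
have := dotmx_mulmx x x M; rewrite Mh xM linearZl_LR linearZr_LR /= => /(mulIf x2) E.
by rewrite {2}E.
Qed.

Lemma proj_dot n (x : 'rV_n) (M : 'M[C]_n) : M ^t* = M -> M *m M = M ->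
  dot (x *m M) (x *m M) = dot (x *m M) x.
Proof. by move=> Mh M2; rewrite [LHS]dotmx_mulmx Mh -mulmxA M2 [RHS]dotmx_mulmx Mh. Qed.

(** Pythagoras: [x *m M] is orthogonal to [x - x *m M], so the difference of the two sides is the
    squared norm of the latter. *)
Lemma proj_dot_le n (x : 'rV_n) (M : 'M[C]_n) : M ^t* = M -> M *m M = M ->
  dot (x *m M) (x *m M) <= dot x x.
Proof.
move=> Mh M2; rewrite -subr_ge0.
have -> : dot x x - dot (x *m M) (x *m M) = dot (x - x *m M) (x - x *m M).
  rewrite linearBl linearBr /= linearBr /= (proj_dot _ Mh M2).
  by rewrite -[X in dot x (_ *m X)]Mh -dotmx_mulmx subrr subr0.
exact: dnorm_ge0.
Qed.

(** Unitary triangularization: [M] is similar to a lower triangular [T] whose diagonal lists the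
    roots of the characteristic polynomial, and powers of [T] stay triangular with the powers of
    that diagonal. *)
Lemma trace_expr_roots n (M : 'M[C]_n) (s : seq C) (a : nat) :
  char_poly M = \prod_(z <- s) ('X - z%:P) -> \tr (M ^+ a) = \sum_(z <- s) z ^+ a.
Proof.
move=> charM.
have [P Pu] : exists2 P : 'M[C]_n, P \is unitarymx & similar_trig P M.
  have [|P Pu /=] := @cotrigonalization C n [:: M].
    by move=> ? ? /=; rewrite !in_cons !orbF => /eqP-> /eqP->.
  by rewrite andbT; exists P.
have Pi := unitarymx_unit Pu.
rewrite /similar_to /= conjumx // => Ttrig.
set T := P *m M *m invmx P in Ttrig.
have charT : char_poly M = \prod_(z <- [seq T i i | i <- index_enum 'I_n]) ('X - z%:P).
  rewrite big_map -char_poly_trig // /T /char_poly /char_poly_mx.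
  have Pp : map_mx polyC P *m map_mx polyC (invmx P) = 1%:M :> 'M[{poly C}]_n.
    by rewrite -map_mxM mulmxV // map_mx1.
  have -> : 'X%:M - map_mx polyC (P *m M *m invmx P) =
     map_mx polyC P *m ('X%:M - map_mx polyC M) *m map_mx polyC (invmx P).
    rewrite !map_mxM mulmxBr mulmxBl; congr (_ - _).
    by rewrite scalar_mxC -mulmxA Pp mulmx1.
  rewrite !det_mulmx mulrAC -det_mulmx.
  by rewrite Pp det1 mul1r.
have permM : perm_eq s [seq T i i | i <- index_enum 'I_n].
  by apply: prod_XsubC_eq; rewrite -charM charT.
rewrite (perm_big _ permM) big_map.
have TX : is_trig_mx (T ^+ a) /\ forall i, (T ^+ a) i i = T i i ^+ a.
  elim: a => [|a [/is_trig_mxP IHt IHd]].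
    by rewrite expr0; split=> [|i]; rewrite ?scalar_mx_is_trig // mxE eqxx.
  move/is_trig_mxP: (Ttrig) => Tt; split.
    apply/is_trig_mxP => i j ltij; rewrite exprS mxE big1 // => k _.
    have [lik|lki] := ltnP i k; first by rewrite Tt // mul0r.
    by rewrite IHt ?mulr0 // (leq_ltn_trans lki).
  move=> i; rewrite exprS mxE (bigD1 i) //= big1 ?addr0 ?IHd ?exprS // => k ki.
  case: (ltngtP i k) ki => [lik|lki|/val_inj->]; last by rewrite eqxx.
    by rewrite Tt // mul0r.
  by rewrite IHt ?mulr0.
have -> : M ^+ a = invmx P *m T ^+ a *m P.
  elim: a {TX} => [|a IH]; first by rewrite !expr0 mulmx1 mulVmx.
  have MT : M *m invmx P = invmx P *m T by rewrite /T !mulmxA mulVmx // mul1mx.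
  by clearbody T; rewrite [LHS]exprS IH exprS -!mulmxE !mulmxA MT.
rewrite -mulmxA mxtrace_mulC -mulmxA mulmxV // mulmx1 /mxtrace.
by apply: eq_bigr => i _; rewrite TX.2.
Qed.

End Hermitian.

Section Spectra.
Variable R : realType.
Local Notation C := R[i].

Lemma char_poly_eigs n (M : 'M[C]_n) : char_poly M = \prod_(z <- eigs M) ('X - z%:P).
Proof.
rewrite /eigs; case: closed_field_poly_normal => r /= {1}->.
by rewrite (monicP (char_poly_monic M)) scale1r.
Qed.

Lemma eigs_trace_expr n (M : 'M[C]_n) (a : nat) :
  \tr (M ^+ a) = \sum_(z <- eigs M) z ^+ a.
Proof. exact: trace_expr_roots (char_poly_eigs M). Qed.

Lemma mem_eigs n (M : 'M[C]_n) z : (z \in eigs M) = eigenvalue M z.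
Proof.
by rewrite eigenvalue_root_char char_poly_eigs root_prod_XsubC.
Qed.

Lemma size_eigs n (M : 'M[C]_n) : size (eigs M) = n.
Proof.
by have := size_char_poly M; rewrite char_poly_eigs size_prod_XsubC => -[].
Qed.

Lemma eigsP n (M : 'M[C]_n) z :
  reflect (exists2 x : 'rV_n, x *m M = z *: x & x != 0) (z \in eigs M).
Proof. by rewrite mem_eigs; apply: eigenvalueP. Qed.

Lemma lambda_max_ge n (M : 'M[C]_n) z : z \in eigs M -> complex.Re z <= lambda_max M.
Proof. by move=> zM; apply: le_bigmax_seq. Qed.

(** The default value in the maximum is the head of the list, hence itself an eigenvalue once [n] is
    positive. *)
Lemma lambda_max_eig n (M : 'M[C]_n) : (0 < n)%N ->
  exists2 z, z \in eigs M & lambda_max M = complex.Re z.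
Proof.
move=> n0; have : (0 < size (eigs M))%N by rewrite size_eigs.
rewrite /lambda_max; case: (eigs M) => // z0 s _ /=; rewrite big_seq.
elim/big_ind: _ => [|x y [zx hx ->] [zy hy ->]|z zs].
- by exists z0; rewrite ?mem_head.
- by case: (leP (complex.Re zx) (complex.Re zy)) => _; [exists zy|exists zx].
- by exists z.
Qed.

Lemma lambda_max0 n (M : 'M[C]_n) : n = 0%N -> lambda_max M = 0.
Proof.
by move=> n0; rewrite /lambda_max (size0nil (etrans (size_eigs M) n0)) big_nil.
Qed.

Local Open Scope sesquilinear_scope.
Local Notation dot := (@dotmx C _).

Section TwoProjections.
Variables (n : nat) (A B : 'M[C]_n).
Hypotheses (Ah : A ^t* = A) (A2 : A *m A = A) (Bh : B ^t* = B) (B2 : B *m B = B).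

(** For an eigenvector [x], [z] times the squared norm of [x] is the squared norm of [x *m A *m B],
    and projections are contractions. *)
Lemma ABA_eig_range z : z \in eigs (A *m B *m A) ->
  exists2 l : R, z = (l%:C)%C & 0 <= l <= 1.
Proof.
case/eigsP => x xM x0; have x2 : 0 < dot x x by rewrite dnorm_gt0.
have E : z * dot x x = dot (x *m A *m B) (x *m A *m B).
  rewrite (proj_dot _ Bh B2) -[X in dot _ (_ *m X)]Ah -dotmx_mulmx.
  by rewrite -!mulmxA (mulmxA A) xM linearZl_LR.
have z0 : 0 <= z by rewrite -(pmulr_lge0 _ x2) E dnorm_ge0.
have z1 : z <= 1.
  rewrite -(ler_pM2r x2) mul1r E.
  by apply: le_trans (proj_dot_le _ Bh B2) (proj_dot_le _ Ah A2).
have /complex_realP[l zl] : z \is Num.real by rewrite realE z0.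
by exists l => //; move: z0 z1; rewrite zl -(rmorph1 (real_complex R)) ler0c lecR => -> ->.
Qed.

End TwoProjections.
End Spectra.

(** * The product of the normalized projections *)

(* The identity behind [W_add], over an abstract ring and with [AB], [BA] as atoms. *)
Lemma projection_expansion (K : comPzRingType) n (A B AB BA : 'M[K]_n) (s t : K) :
  AB - t *: A - (s *: B - t *: s%:M) +
  (BA - (1 - s) *: B - ((1 - t) *: A - (1 - s) *: (1 - t)%:M)) =
  1%:M - (A - AB - (BA - B)) - (s + t - 2 * s * t)%:M.
Proof.
apply/matrixP => i j; rewrite !mxE.
by case: (i == j); rewrite ?mulr1n ?mulr0n; ring.
Qed.

(** [z + z^-1] is an eigenvalue of the Hermitian matrix [V + V'], hence real. Its imaginary part
    vanishes exactly when [z] is real or of modulus 1, by the factorization used below. *)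
Lemma eig_inv_sum_herm (C : numClosedFieldType) n (V V' : 'M[C]_n) (x : 'rV_n) (z : C) :
  V *m V' = 1%:M -> map_mx Num.conj (V + V')^T = V + V' ->
  x != 0 -> x *m V = z *: x -> z^* = z \/ z * z^* = 1.
Proof.
move=> VV' Vh x0 xV.
have xE : z *: (x *m V') = x by rewrite scalemxAl -xV -mulmxA VV' mulmx1.
have z0 : z != 0 by apply: contraNneq x0 => z0; rewrite -xE z0 scale0r.
have xV' : x *m V' = z^-1 *: x by rewrite -[in RHS]xE scalerA mulVf // scale1r.
have xS : x *m (V + V') = (z + z^-1) *: x by rewrite mulmxDr xV xV' scalerDl.
have E := hermitian_eig_real Vh x0 xS; rewrite rmorphD fmorphV in E.
have zc0 : z^* != 0 by rewrite conjC_eq0.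
have : (z^* - z) * (z * z^* - 1) = 0.
  have -> : (z^* - z) * (z * z^* - 1) = z * z^* * ((z^* + z^*^-1) - (z + z^-1)).
    by field; rewrite z0.
  by rewrite E subrr mulr0.
by move/eqP; rewrite mulf_eq0 !subr_eq0 => /orP[]/eqP; [left|right].
Qed.

(** Applying [V] to the relation on [x] gives [x (V^2 - t V + 1) = 0], which factors as
    [x (V - z') (V - z) = 0]. The vector [x (V - z')] is therefore an eigenvector for [z], unless it
    vanishes. *)
Lemma eig_quadratic (K : fieldType) n (V V' : 'M[K]_n) (x : 'rV_n) (t z z' : K) :
  V' *m V = 1%:M -> x *m V + x *m V' = t *: x -> z + z' = t -> z * z' = 1 ->
  (x *m V - z' *: x) *m V = z *: (x *m V - z' *: x).
Proof.
move=> V'V xS zt zz'.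
have xVV : x *m V *m V = t *: (x *m V) - x.
  apply/eqP; rewrite -subr_eq opprK scalemxAl -xS mulmxDl -(mulmxA x V') V'V.
  by rewrite mulmx1.
rewrite mulmxBl xVV -scalemxAl scalerBr scalerA zz' scale1r addrAC -scalerBl.
by rewrite -zt addrK.
Qed.

Lemma mulmx_normalize_fix (K : comPzRingType) n (M : 'M[K]_n) (x : 'rV_n) (s t : K) :
  x *m M = x -> x *m (s *: (M - t%:M)) = (s * (1 - t)) *: x.
Proof.
by move=> xM; rewrite -scalemxAr mulmxBr xM mul_mx_scalar -scalerA scalerBl scale1r.
Qed.

Section NormalizedProduct.
Local Open Scope sesquilinear_scope.
Variables (R : realType) (n : nat).
Local Notation C := R[i].
Variables (A B : 'M[C]_n) (a b : R).
Hypotheses (Ah : A ^t* = A) (A2 : A *m A = A) (Bh : B ^t* = B) (B2 : B *m B = B).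
Hypotheses (a01 : 0 < a < 1) (b01 : 0 < b < 1).

Let sa := Num.sqrt (a * (1 - a)).
Let sb := Num.sqrt (b * (1 - b)).
Let W := normalize a A *m normalize b B.
(** The inverse of [W]: since [(M - c) (M - (1 - c)) = c (1 - c)] for a projection [M], replacing
    [c] by [1 - c] inverts each normalized factor. *)
Let W' := normalize (1 - b) B *m normalize (1 - a) A.

Lemma scale_realB (c e : R) (x : 'rV[C]_n) :
  ((c - e)%:C)%C *: x = (c%:C)%C *: x - (e%:C)%C *: x.
Proof. by rewrite rmorphB scalerBl. Qed.

Lemma scale_realM (c e : R) (x : 'rV[C]_n) :
  ((c * e)%:C)%C *: x = (c%:C)%C *: ((e%:C)%C *: x).
Proof. by rewrite rmorphM scalerA. Qed.

Lemma sqrt_mul_compl_gt0 (c : R) : 0 < c < 1 -> 0 < Num.sqrt (c * (1 - c)).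
Proof. by move=> c01; rewrite sqrtr_gt0 mulr_gt0 //; lra. Qed.

Lemma normalize_mulC (M : 'M[C]_n) (c : R) : M *m M = M -> 0 < c < 1 ->
  normalize c M *m normalize (1 - c) M = 1%:M.
Proof.
move=> M2 c01; have s0 := sqrt_mul_compl_gt0 c01.
rewrite /normalize (_ : (1 - c) * (1 - (1 - c)) = c * (1 - c)); last by ring.
rewrite -scalemxAl -scalemxAr scalerA mulmxBl !mulmxBr M2.
rewrite mul_mx_scalar !mul_scalar_mx.
have -> : M - ((1 - c)%:C)%C *: M - ((c%:C)%C *: M - (c%:C)%C *: ((1 - c)%:C%C)%:M)
   = ((c * (1 - c))%:C%C)%:M.
  apply/matrixP => i j; rewrite !mxE !rmorphM !rmorphB !rmorph1.
  by case: (i == j); rewrite ?mulr1n ?mulr0n; ring.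
have p0 : 0 < c * (1 - c) by rewrite -sqrtr_gt0.
rewrite scale_scalar_mx -rmorphM -rmorphM /= -invfM -expr2 sqr_sqrtr ?ltW //.
by rewrite mulVf ?gt_eqF // rmorph1.
Qed.

Lemma W_mulV : W *m W' = 1%:M.
Proof.
rewrite /W /W' -(mulmxA (normalize a A)) (mulmxA (normalize b B)).
by rewrite (normalize_mulC B2 b01) mul1mx (normalize_mulC A2 a01).
Qed.

Lemma W_mulV' : W' *m W = 1%:M.
Proof. by rewrite mulmx1C // W_mulV. Qed.

(** The linear terms of the two products combine so that [A B + B A - A - B = - (A - B)^2] appears.
    This gives both the Hermitian symmetry of the sum and its link with the spectrum of [A B A]. *)
Lemma W_add : W + W' = ((sa * sb)^-1)%:C%C *:
  (1%:M - (A - B) *m (A - B) - ((a + b - 2 * a * b)%:C%C)%:M).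
Proof.
rewrite /W /W' /normalize.
rewrite (_ : (1 - b) * (1 - (1 - b)) = b * (1 - b)); last by ring.
rewrite (_ : (1 - a) * (1 - (1 - a)) = a * (1 - a)); last by ring.
rewrite -/sa -/sb invfM -!scalemxAl -!scalemxAr !scalerA -!rmorphM /=.
rewrite [sb^-1 * sa^-1]mulrC -scalerDr; congr (_ *: _).
rewrite !(mulmxBl, mulmxBr) A2 B2 !mul_mx_scalar !mul_scalar_mx.
move: (A *m B) (B *m A) => AB BA.
have -> : ((a + b - 2 * a * b)%:C)%C = a%:C%C + b%:C%C - 2 * a%:C%C * b%:C%C.
  by rewrite rmorphB rmorphD !rmorphM rmorph_nat.
have E1 (c : R) : ((1 - c)%:C)%C = 1 - c%:C%C by rewrite rmorphB rmorph1.
by rewrite !E1; exact: projection_expansion.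
Qed.

Lemma W_add_herm : (W + W') ^t* = W + W'.
Proof.
have adjB (X Y : 'M[C]_n) : (X - Y) ^t* = X ^t* - Y ^t* by rewrite raddfB /= raddfB.
have Sh (c : R) : (((c%:C)%C)%:M : 'M[C]_n) ^t* = ((c%:C)%C)%:M.
  by rewrite tr_scalar_mx map_scalar_mx; congr (_%:M); exact: conjc_real.
have adj1 : (1%:M : 'M[C]_n) ^t* = 1%:M by rewrite tr_scalar_mx map_scalar_mx rmorph1.
rewrite W_add linearZ /= map_mxZ; congr (_ *: _); first exact: conjc_real.
by rewrite !adjB adj1 Sh trmx_mul map_mxM adjB Ah Bh.
Qed.

Lemma W_eig (x : 'rV[C]_n) (z : C) : x != 0 -> x *m W = z *: x -> z^* = z \/ z * z^* = 1.
Proof. exact: eig_inv_sum_herm W_mulV W_add_herm. Qed.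

(** An even power of a real eigenvalue is nonnegative; any power of a unimodular one has modulus
    1. *)
Lemma W_eigs_even (z : C) m : z \in eigs W -> -1 <= complex.Re (z ^+ m.*2).
Proof.
case/eigsP => x xW /W_eig/(_ xW) [zr|z1].
  have /complex_realP[r ->] : z \is Num.real by rewrite CrealE; apply/eqP.
  rewrite -rmorphXn /= -muln2 mulnC exprM.
  by apply: le_trans (exprn_ge0 _ (sqr_ge0 r)); rewrite lerN10.
have : `|z ^+ m.*2| = 1.
  by rewrite normrX -muln2 mulnC exprM normCK z1 expr1n.
move: (z ^+ _) => y y1; have := normc_ge_Re y.
rewrite y1 -(rmorph1 (real_complex R)) lecR => /ler_normlP[]; lra.
Qed.

(** In this form the edge is the value of [l] at which [t = (l - (a + b - 2ab)) / (sa sb)] equals 2,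
    the threshold beyond which [z + z^-1 = t] has a real solution larger than 1. *)
Lemma r_plusE : r_plus a b = a + b - 2 * a * b + 2 * (sa * sb).
Proof.
have [a0 a1] := andP a01; have [b0 b1] := andP b01.
have [p0 q0] : 0 <= a * (1 - b) /\ 0 <= b * (1 - a) by split; apply: mulr_ge0; lra.
rewrite /r_plus sqrrD !sqr_sqrtr // -sqrtrM //.
have -> : a * (1 - b) * (b * (1 - a)) = a * (1 - a) * (b * (1 - b)) by ring.
by rewrite sqrtrM -/sa -/sb; [ring|apply: mulr_ge0; lra].
Qed.

(** An eigenvector [x] of [A B A] with [l] nonzero is fixed by [A], so [x (A - B)^2 = (1 - l) x] and
    [x] is an eigenvector of [W + W'] with eigenvalue [t > 2]. The roots [z > 1 > z'] of
    [u^2 - t u + 1] then feed [eig_quadratic], and [z >= t / 2] gives the bound. *)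
Lemma ABA_eig_W (l e : R) : a + b <= 1 -> 0 < e ->
  (l%:C)%C \in eigs (A *m B *m A) -> r_plus a b + e <= l ->
  exists2 w : R, (w%:C)%C \in eigs W & 1 + e / (2 * (sa * sb)) <= w.
Proof.
move=> ab1 e0 /eigsP[x xM x0]; rewrite r_plusE => le_l.
have sa0 : 0 < sa by exact: sqrt_mul_compl_gt0.
have sb0 : 0 < sb by exact: sqrt_mul_compl_gt0.
have [a0 a1] := andP a01; have [b0 b1] := andP b01.
have s0 : 0 < sa * sb by exact: mulr_gt0.
have l0 : 0 < l.
  have : 0 < r_plus a b + e by rewrite ltr_wpDl // sqr_ge0.
  by rewrite r_plusE => /lt_le_trans; apply.
have lC : (l%:C)%C != 0 by rewrite -(rmorph0 (real_complex R)) (inj_eq (@complexI R)) gt_eqF.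
have xA : x *m A = x.
  apply: (scalerI lC); rewrite scalemxAl -xM -!mulmxA A2 !mulmxA; exact.
have xBA : x *m B *m A = (l%:C)%C *: x by rewrite -xM !mulmxA xA.
set t := (l - (a + b - 2 * a * b)) / (sa * sb).
have xH : x *m W + x *m W' = (t%:C)%C *: x.
  have xD : x *m ((A - B) *m (A - B)) = x - (l%:C)%C *: x.
    rewrite mulmxA !mulmxBr mulmxBl xA xBA mulmxBl xA -(mulmxA x B B) B2 subrr subr0 //.
  rewrite -mulmxDr W_add -scalemxAr mulmxBr mulmxBr xD mulmx1 mul_mx_scalar /t.
  rewrite [_ / _]mulrC scale_realM; congr (_ *: _).
  rewrite [RHS]scale_realB; congr (_ - _); exact: subKr.
set d := Num.sqrt (t ^+ 2 - 4).
have t2 : 2 + e / (sa * sb) <= t.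
  rewrite /t ler_pdivlMr // mulrDl divfK ?gt_eqF //; lra.
have es0 : 0 < e / (sa * sb) by rewrite divr_gt0.
have d2 : d ^+ 2 = t ^+ 2 - 4 by rewrite sqr_sqrtr //; nra.
have d0 : 0 <= d by exact: sqrtr_ge0.
have dt : d < t by nra.
set z := (t + d) / 2; set z' := (t - d) / 2.
have zz' : z * z' = 1 by rewrite /z /z'; nra.
have z'0 : 0 < z' by rewrite /z'; lra.
have zt : t / 2 <= z by rewrite /z; lra.
have z'1 : z' < 1 by nra.
exists z; last first.
  by apply: le_trans zt; rewrite invfM mulrCA mulrA; lra.
pose y := x *m W - (z'%:C)%C *: x.
have yW : y *m W = (z%:C)%C *: y.
  apply: (@eig_quadratic C n W W' x (t%:C)%C (z%:C)%C (z'%:C)%C W_mulV' xH).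
    by rewrite -rmorphD /=; congr ((_)%:C%C); rewrite /z /z'; lra.
  by rewrite -rmorphM /= zz' rmorph1.
(* [(W - z)(W - z')] kills [x]. If [y = x (W - z')] vanishes, then [x] is an
   eigenvector of [B] too, so [l = 1] and [z' = (1 - a)(1 - b) / (sa sb) >= 1]. *)
have [y0|y0] := eqVneq y 0; last by apply/eigsP; exists y.
exfalso.
have xU : x *m normalize a A = ((sa^-1 * (1 - a))%:C)%C *: x.
  rewrite (mulmx_normalize_fix _ _ xA); congr (_ *: _).
  by rewrite rmorphM rmorphB rmorph1.
have a1' : 1 - a != 0 by rewrite gt_eqF // subr_gt0.
(* [q] is obtained by solving [x W = z' x] for the eigenvalue of [B], knowing that [A] fixes [x]. *)
pose q := z' * (sa * sb) / (1 - a) + b.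
have xB : x *m B = (q%:C)%C *: x.
  have : x *m W = (z'%:C)%C *: x by apply/eqP; rewrite -subr_eq0 -/y y0.
  rewrite /W mulmxA xU -scalemxAl /normalize -scalemxAr mulmxBr mul_mx_scalar -/sb.
  move=> /(congr1 (fun v => (((sa * sb) / (1 - a))%:C)%C *: v)).
  rewrite !scalerA -!rmorphM /=.
  have -> : sa * sb / (1 - a) * (sa^-1 * (1 - a)) * sb^-1 = 1.
    by field; rewrite a1' !gt_eqF.
  rewrite rmorph1 scale1r => /eqP; rewrite subr_eq => /eqP ->.
  by rewrite -scalerDl -rmorphD; congr ((_)%:C%C *: _); rewrite /q; ring.
have scal_inj (r1 r2 : R) : (r1%:C)%C *: x = (r2%:C)%C *: x -> r1 = r2.
  move=> /eqP; rewrite -subr_eq0 -scalerBl scaler_eq0 (negbTE x0) orbF subr_eq0.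
  by move=> /eqP /complexI.
have ql : q = l by apply: scal_inj; rewrite -xBA xB -scalemxAl xA.
have qq : q * q = q.
  by apply: scal_inj; rewrite rmorphM -scalerA -xB scalemxAl -xB -mulmxA B2.
have q1 : q = 1.
  by move/eqP: qq; rewrite -subr_eq0 -{3}[q]mulr1 -mulrBr mulf_eq0 ql gt_eqF //= subr_eq0 => /eqP.
have sE : z' * (sa * sb) = (1 - a) * (1 - b).
  by move: q1; rewrite /q => /(congr1 (fun u => (u - b) * (1 - a))); rewrite addrK divfK // [RHS]mulrC.
have s2 : (sa * sb) ^+ 2 = (a * b) * ((1 - a) * (1 - b)).
  have [pa pb] : 0 <= a * (1 - a) /\ 0 <= b * (1 - b) by split; apply: mulr_ge0; lra.
  by rewrite exprMn !sqr_sqrtr //; ring.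
(* From [z' < 1]: squaring and dividing by [(1 - a) (1 - b)] leaves [(1 - a) (1 - b) < a b],
   contrary to [a + b <= 1]. *)
have lt_s : (1 - a) * (1 - b) < sa * sb by rewrite -sE gtr_pMl.
have pp : 0 < (1 - a) * (1 - b) by apply: mulr_gt0; lra.
have : ((1 - a) * (1 - b)) ^+ 2 < (sa * sb) ^+ 2.
  by rewrite ltr_pXn2r // nnegrE ltW.
by rewrite s2 expr2 ltr_pM2r //; nra.
Qed.

(** Stated for any list of eigenvalues, so that it also applies to the spectrum with one outlier
    removed. *)
Lemma sum_eigs_even_ge (s : seq C) m : {subset s <= eigs W} ->
  - (size s)%:R <= complex.Re (\sum_(z <- s) z ^+ m.*2).
Proof.
elim: s => [|z s IH] sW; first by rewrite big_nil oppr0.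
rewrite big_cons raddfD /= -natr1 opprD addrC lerD //.
  by apply: W_eigs_even; apply: sW; rewrite mem_head.
by apply: IH => y ys; apply: sW; rewrite in_cons ys orbT.
Qed.

Lemma trace_W_even_ge m : - n%:R <= complex.Re (\tr (W ^+ m.*2)).
Proof. by rewrite eigs_trace_expr -{1}(size_eigs W) sum_eigs_even_ge. Qed.

(** One copy of the real eigenvalue from [ABA_eig_W] is split off; the other [n - 1] eigenvalues
    contribute at least [- n]. *)
Lemma trace_W_outlier e m : a + b <= 1 -> 0 < e ->
  r_plus a b + e <= lambda_max (A *m B *m A) ->
  (1 + e / (2 * (sa * sb))) ^+ m.*2 - n%:R <= complex.Re (\tr (W ^+ m.*2)).
Proof.
move=> ab1 e0 le_max.
have [n0|n0] := posnP n.
  exfalso; have : 0 < r_plus a b + e by rewrite ltr_wpDl // sqr_ge0.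
  by move: le_max; rewrite lambda_max0 // => /le_lt_trans H /H; rewrite ltxx.
have [z zE zM] := lambda_max_eig (A *m B *m A) n0.
have [l zl _] := ABA_eig_range Ah A2 Bh B2 zE.
have lE : (l%:C)%C \in eigs (A *m B *m A) by rewrite -zl.
have le_l : r_plus a b + e <= l by rewrite zM zl in le_max.
have [w wE ew] := ABA_eig_W ab1 e0 lE le_l.
rewrite eigs_trace_expr (perm_big _ (perm_to_rem wE)) big_cons raddfD /=.
have s0 : 0 < sa * sb by apply: mulr_gt0; exact: sqrt_mul_compl_gt0.
apply: lerD.
  rewrite -rmorphXn /= lerXn2r // ?nnegrE.
    by rewrite addr_ge0 // divr_ge0 ?ltW // mulr_gt0.
  by apply: le_trans ew; rewrite addr_ge0 // divr_ge0 ?ltW // mulr_gt0.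
apply: le_trans (sum_eigs_even_ge _ _); last by move=> y /mem_rem.
by rewrite lerN2 ler_nat size_rem // size_eigs leq_pred.
Qed.

End NormalizedProduct.

(** * Rayleigh quotients, trace moments and the operator norm *)

Section RayleighAndOpnorm.
Local Open Scope sesquilinear_scope.
Variable R : realType.
Local Notation C := R[i].
Local Notation dot := (@dotmx C _).

(** In the coordinates of a unitary diagonalization both sides are sums of squared moduli, weighted
    by eigenvalues on the left. *)
Lemma rayleigh_le n (M : 'M[C]_n) (x : 'rV_n) : M ^t* = M ->
  dot (x *m M) x <= (lambda_max M)%:C%C * dot x x.
Proof.
move=> Mh.
have Mherm : M \is hermsymmx.
  by apply/is_hermitianmxP; rewrite expr0 scale1r Mh.
have /orthomx_spectralP := hermitian_normalmx Mherm.
set P := spectralmx M; set D := spectral_diag M => ME.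
have Pu : P \is unitarymx := spectral_unitarymx M.
have Punit := unitarymx_unit Pu.
have dE i : (D 0 i) \in eigs M.
  apply/eigsP; exists (row i P); last first.
    apply/eqP => P0; have /(congr1 (fun v => v *m invmx P)) := P0.
    rewrite -row_mul mulmxV // mul0mx => /rowP /(_ i).
    by rewrite !mxE eqxx => /eqP; rewrite oner_eq0.
  rewrite -row_mul ME !mulmxA mulmxV // mul1mx row_mul row_diag_mx.
  by rewrite -scalemxAl -rowE.
have dr i : D 0 i <= (lambda_max M)%:C%C.
  have /eigsP[v vM v0] := dE i.
  have /complex_realP[r rE] : D 0 i \is Num.real.
    by rewrite CrealE; apply/eqP; exact: hermitian_eig_real Mh v0 vM.
  by have := lambda_max_ge (dE i); rewrite rE lecR.
have Pi : invmx P = P ^t* by exact: invmx_unitary.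
have xE : x = x *m P ^t* *m P by rewrite -mulmxA -Pi mulVmx // mulmx1.
set y := x *m P ^t* in xE.
have -> : dot (x *m M) x = dot (y *m diag_mx D) y.
  by rewrite ME Pi !mulmxA -/y dotmx_mulmx.
have -> : dot x x = dot y y by rewrite {1}xE dotmx_mulmx.
move: y {xE} => y; rewrite !dotmxE !mxE mulr_sumr; apply: ler_sum => i _.
rewrite mul_mx_diag !mxE mulrAC [leRHS]mulrC; apply: ler_wpM2l; last exact: dr.
by rewrite mul_conjC_ge0.
Qed.

(** Passes from the column vectors of [opnorm] to the row vectors on which the Hermitian form [dot]
    lives. *)
Lemma vnorm_sqr n (v : 'cV[C]_n) : ((vnorm v) ^+ 2)%:C%C = dot (v ^t*) (v ^t*).
Proof.
rewrite /vnorm sqr_sqrtr ?sumr_ge0 // => [|i _]; last by rewrite addr_ge0 ?sqr_ge0.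
rewrite rmorph_sum dotmxE mxE; apply: eq_bigr => i _ /=.
by rewrite /csqnorm add_Re2_Im2 normCK !mxE conjCK mulrC.
Qed.

Lemma dot_adj_scale n (c : R) (v : 'cV[C]_n) : 0 <= c ->
  dot ((c%:C%C *: v) ^t*) ((c%:C%C *: v) ^t*) = (c ^+ 2)%:C%C * dot (v ^t*) (v ^t*).
Proof.
move=> c0; rewrite linearZ /= map_mxZ dnormZ /= norm_conjC.
by rewrite ger0_norm ?ler0c // -rmorphXn.
Qed.

Section ABA.
Variables (n : nat) (A B : 'M[C]_n).
Hypotheses (Ah : A ^t* = A) (A2 : A *m A = A) (Bh : B ^t* = B) (B2 : B *m B = B).
Let M := A *m B *m A.
Let L := lambda_max M.

Lemma ABA_herm : M ^t* = M.
Proof. by rewrite !trmx_mul !map_mxM Ah Bh mulmxA. Qed.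

Lemma lambda_max_ABA_range : 0 <= L <= 1.
Proof.
have [n0|n0] := posnP n.
  by rewrite /L lambda_max0 // lexx ler01.
have [z zM LE] := lambda_max_eig M n0.
have [l zl l01] := ABA_eig_range Ah A2 Bh B2 zM.
by rewrite /L LE zl.
Qed.

Lemma eigs_ABA z : z \in eigs M -> z = (complex.Re z)%:C%C /\ 0 <= complex.Re z <= L.
Proof.
move=> zM; have [l zl /andP[l0 l1]] := ABA_eig_range Ah A2 Bh B2 zM.
have := lambda_max_ge zM; rewrite -/L zl /= => ->.
by rewrite l0.
Qed.

Lemma Re_trace_ABA m : complex.Re (\tr (M ^+ m)) = \sum_(z <- eigs M) (complex.Re z) ^+ m.
Proof.
rewrite eigs_trace_expr raddf_sum /= [LHS]big_seq [RHS]big_seq.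
apply: eq_bigr => z /eigs_ABA[zr _]; rewrite [in LHS]zr. by rewrite -rmorphXn.
Qed.

Lemma trace_ABA_le m : complex.Re (\tr (M ^+ m)) <= n%:R * L ^+ m.
Proof.
rewrite Re_trace_ABA big_seq.
apply: (@le_trans _ _ (\sum_(z <- eigs M) L ^+ m)).
  rewrite [leRHS]big_seq; apply: ler_sum => z /eigs_ABA[_ /andP[z0 zL]].
  by rewrite lerXn2r // nnegrE (le_trans z0).
by rewrite big_const_seq count_predT iter_addr_0 size_eigs mulr_natl.
Qed.

Lemma trace_ABA_ge m : (0 < n)%N -> L ^+ m <= complex.Re (\tr (M ^+ m)).
Proof.
move=> n0; have [z zM LE] := lambda_max_eig M n0.
rewrite Re_trace_ABA (perm_big _ (perm_to_rem zM)) big_cons -/L /L LE lerDl.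
rewrite big_seq; apply: sumr_ge0 => y /mem_rem /eigs_ABA[_ /andP[y0 _]].
exact: exprn_ge0.
Qed.

(** Reduces a condition on [lambda_max] to countably many conditions on traces, whose measurability
    is clear. For the converse, [L ^+ m <= n c ^+ m] for all [m] is impossible when [L > c], by
    exponential growth. *)
Lemma lambda_max_ABA_leP c : 0 <= c ->
  (L <= c) <-> (forall m, complex.Re (\tr (M ^+ m)) <= n%:R * c ^+ m).
Proof.
move=> c0; have /andP[L0 L1] := lambda_max_ABA_range; split=> [Lc m|H].
  apply: le_trans (trace_ABA_le m) _.
  by apply: ler_wpM2l => //; rewrite lerXn2r.
have [n0|n0] := posnP n.
  by rewrite /L lambda_max0.
rewrite leNgt; apply/negP => cL.
have {}H m : L ^+ m <= n%:R * c ^+ m by apply: le_trans (trace_ABA_ge m n0) (H m).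
have [c00|c00] := eqVneq c 0.
  by have := H 1%N; rewrite c00 expr1 expr0n mulr0 leNgt -{1}c00 cL.
have {c00}c0 : 0 < c by rewrite lt_def c00.
pose h := L / c - 1.
have h0 : 0 < h by rewrite subr_gt0 ltr_pdivlMr // mul1r.
(* With [m h > n], Bernoulli's inequality gives [(1 + h) ^+ m > n]. *)
pose m := Num.bound (n%:R / h).
have := H m; rewrite -ler_pdivrMr ?exprn_gt0 // -expr_div_n leNgt => /negP; apply.
have -> : L / c = 1 + h by rewrite addrC subrK.
have nm : n%:R < m%:R * h.
  by rewrite -ltr_pdivrMr //; apply: archi_boundP; rewrite divr_ge0 // ltW.
apply: lt_le_trans nm _; elim: m => [|m IH]; first by rewrite mul0r expr0.
have X1 : 1 <= (1 + h) ^+ m by rewrite exprn_ege1 // lerDl ltW.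
by rewrite exprS -natr1 mulrDl; nra.
Qed.

Lemma vnorm_eq (v : 'cV[C]_n) r : 0 <= r -> dot (v ^t*) (v ^t*) = (r ^+ 2)%:C%C ->
  vnorm v = r.
Proof.
move=> r0; rewrite -vnorm_sqr => /complexI /eqP.
by rewrite eqrXn2 ?sqrtr_ge0 // => /eqP.
Qed.

(** Let [y] be the adjoint of [v] and [x = y B A], of norm [X]. Then the form of [x B] and [y]
    equals [X^2], while Rayleigh bounds the squared norm of [x B] by [L X^2]. Cauchy-Schwarz,
    written as nonnegativity of the squared norm of [x B - X^2 y], yields [X^4 <= L X^2]. *)
Lemma vnorm_AB_le (v : 'cV[C]_n) : vnorm v = 1 -> vnorm (A *m B *m v) ^+ 2 <= L.
Proof.
move=> v1; set X := vnorm _; set y := v ^t*.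
have yy : dot y y = 1 by rewrite -vnorm_sqr v1 expr1n rmorph1.
pose x := y *m B *m A.
have xx : dot x x = (X ^+ 2)%:C%C.
  by rewrite vnorm_sqr !trmx_mul !map_mxM Ah Bh mulmxA.
have xA : x *m A = x by rewrite /x -!mulmxA A2.
have xBy : dot (x *m B) y = (X ^+ 2)%:C%C.
  by rewrite dotmx_mulmx Bh -[in LHS]xA dotmx_mulmx Ah -/x.
have xBB : dot (x *m B) (x *m B) <= (L * X ^+ 2)%:C%C.
  rewrite (proj_dot _ Bh B2) -[in leLHS]xA rmorphM /= -xx.
  have -> : dot (x *m A *m B) (x *m A) = dot (x *m M) x.
    by rewrite xA /M !mulmxA xA -[in LHS]xA [in RHS]dotmx_mulmx Ah xA.
  exact: rayleigh_le ABA_herm.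
have := @dnorm_ge0 C _ (@dotmx C n) (x *m B - (X ^+ 2)%:C%C *: y).
rewrite dnormB dnormZ /= yy mulr1 linearZr_LR /= xBy.
have -> : `|(X ^+ 2)%:C%C| = (X ^+ 2)%:C%C :> C.
  by rewrite ger0_norm // ler0c sqr_ge0.
have -> : ((X ^+ 2)%:C%C)^* = (X ^+ 2)%:C%C :> C by exact: conjc_real.
rewrite -!rmorphM /= (_ : ((X ^+ 2 * X ^+ 2)%:C%C)^* = (X ^+ 2 * X ^+ 2)%:C%C :> C); last exact: conjc_real.
rewrite expr2 -rmorphM /= opprD addrA addrK subr_ge0 => /le_trans/(_ xBB).
rewrite lecR; have [->|X0] := eqVneq (X ^+ 2) 0.
  by have /andP[] := lambda_max_ABA_range.
by rewrite ler_pM2r // lt_def X0 sqr_ge0.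
Qed.

(** For [L > 0] and a top eigenvector [x] of [A B A], the maximizer is the normalized adjoint of
    [x B], because [x B A = L x]. For [L = 0] any unit vector serves, by [vnorm_AB_le]. *)
Lemma vnorm_AB_attained : (0 < n)%N ->
  exists2 v : 'cV[C]_n, vnorm v = 1 & vnorm (A *m B *m v) = Num.sqrt L.
Proof.
move=> n0; have /andP[] := lambda_max_ABA_range; rewrite le_eqVlt => /predU1P[L0|L0] _.
  pose i := Ordinal n0; have v1 : vnorm (delta_mx i 0 : 'cV[C]_n) = 1.
    apply: vnorm_eq => //; rewrite expr1n rmorph1 dotmxE mxE (bigD1 i) //= big1.
      by rewrite !mxE !eqxx /= conjCK rmorph1 mulr1 addr0.
    by move=> j ji; rewrite !mxE (negbTE ji) /= rmorph0 mul0r.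
  exists (delta_mx i 0) => //; apply/eqP.
  by rewrite -L0 sqrtr0 -sqrf_eq0 eq_le sqr_ge0 andbT L0 vnorm_AB_le.
have [z zM LE] := lambda_max_eig M n0.
have [zr _] := eigs_ABA zM; move: zM; rewrite zr -LE -/L => /eigsP[x xM x0].
have LC : (L%:C)%C != 0 by rewrite -(rmorph0 (real_complex R)) (inj_eq (@complexI R)) gt_eqF.
have xA : x *m A = x.
  by apply: (scalerI LC); rewrite scalemxAl -xM /M -!mulmxA A2 !mulmxA.
have xBA : x *m B *m A = (L%:C)%C *: x by rewrite -xM /M !mulmxA xA.
have [d dE] : exists d : R, dot x x = d%:C%C.
  by apply/complex_realP; rewrite realE dnorm_ge0.
have d0 : 0 < d.
  have : 0 < dot x x by rewrite dnorm_gt0.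
  by rewrite dE -(rmorph0 (real_complex R)) ltcR.
have rr : dot (x *m B) (x *m B) = (L * d)%:C%C.
  rewrite (proj_dot _ Bh B2) -[X in dot _ X]xA -[X in dot _ (_ *m X)]Ah -dotmx_mulmx xBA.
  by rewrite linearZl_LR /= dE rmorphM.
pose c := (Num.sqrt (L * d))^-1.
have Ld : 0 < L * d by rewrite mulr_gt0.
have c2 : c ^+ 2 = (L * d)^-1 by rewrite exprVn sqr_sqrtr // ltW.
have c0 : 0 <= c by rewrite invr_ge0 sqrtr_ge0.
exists ((c%:C)%C *: (x *m B) ^t*).
  apply: vnorm_eq => //; rewrite dot_adj_scale // trmxCK rr -rmorphM /= c2.
  by rewrite mulVf ?gt_eqF // expr1n.
apply: vnorm_eq; first exact: sqrtr_ge0.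
have -> : A *m B *m ((c%:C)%C *: (x *m B) ^t*) = (c%:C)%C *: ((L%:C)%C *: x) ^t*.
  by rewrite -scalemxAr -xBA !trmx_mul !map_mxM Ah Bh !mulmxA -(mulmxA A B B) B2.
rewrite dot_adj_scale // trmxCK dnormZ /= dE ger0_norm; last by rewrite ler0c ltW.
rewrite -rmorphXn -!rmorphM /= c2 sqr_sqrtr ?ltW //; congr (_%:C)%C.
by field; rewrite !gt_eqF.
Qed.

Lemma opnorm_AB : L = opnorm (A *m B) ^+ 2.
Proof.
have /andP[L0 _] := lambda_max_ABA_range.
suff -> : opnorm (A *m B) = Num.sqrt L by rewrite sqr_sqrtr.
(* In dimension 0 there is no unit vector; the supremum of the empty set and [lambda_max] are both 0
   by convention. *)
have [n0|n0] := posnP n.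
  have -> : L = 0 by rewrite /L lambda_max0.
  rewrite sqrtr0 /opnorm (_ : [set _ | _ in _] = set0) ?sup0 //.
  apply/seteqP; split=> // r [v /= v1 _]; exfalso; move: v1.
  rewrite /vnorm big1 => [|i _]; last by have := ltn_ord i; rewrite {2}n0.
  by rewrite sqrtr0 => /eqP; rewrite eq_sym oner_eq0.
have [v v1 vL] := vnorm_AB_attained n0.
have ubS : ubound [set vnorm (A *m B *m v) | v in [set v : 'cV[C]_n | vnorm v = 1]] (Num.sqrt L).
  move=> _ [w /= w1 <-].
  have X0 : 0 <= vnorm (A *m B *m w) by exact: sqrtr_ge0.
  by rewrite -(ger0_norm X0) -sqrtr_sqr ler_sqrt // vnorm_AB_le.
apply/eqP; rewrite eq_le; apply/andP; split.
  by apply: ge_sup => //; exists (vnorm (A *m B *m v)); exists v.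
apply: ub_le_sup; first by exists (Num.sqrt L).
by exists v.
Qed.

End ABA.
End RayleighAndOpnorm.

(** * Test functions for the MANOVA law *)

Section ManovaTestFunctions.
Variable R : realType.

(* Agrees with the identity on [[0, 1]]: the test functions below are then polynomials on
   the spectrum of [A B A], so their spectral integrals are measurable. *)
Definition tent (x : R) : R := Num.max 0 (Num.min x (2 - x)).

Lemma tent_continuous : continuous tent.
Proof.
move=> x.
have sub_cont : {for x, continuous (fun y : R => 2 - y)}.
  by apply: continuousB; [exact: cst_continuous|exact: cvg_id].
have min_cont := @continuous_min R R id (fun y => 2 - y) x (@cvg_id _ _) sub_cont.
exact: (@continuous_max R R (cst 0) _ x (@cst_continuous _ _ _ _) min_cont).
Qed.

Lemma tent_id x : 0 <= x <= 1 -> tent x = x.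
Proof. by move=> /andP[x0 x1]; rewrite /tent min_l ?max_r //; lra. Qed.

Lemma tent_out x : 2 < `|x| -> tent x = 0.
Proof.
move=> x2; rewrite /tent max_l //; rewrite ge_min.
have [x0|x0] := leP x 0 => //=.
by rewrite gtr0_norm // in x2; lra.
Qed.

Definition test_pow (m : nat) (x : R) : R := tent x ^+ m.
(* The factor [1 - x] cancels the singularity of the density at 1 when [a + b = 1]. *)
Definition test_edge (m : nat) (x : R) : R := tent x ^+ m * (1 - x).

Lemma test_pow_continuous m : continuous (test_pow m).
Proof.
move=> x; apply: (@continuous_comp _ _ _ tent (fun y => y ^+ m)).
  exact: tent_continuous.
exact: exprn_continuous.
Qed.

Lemma test_edge_continuous m : continuous (test_edge m).
Proof.
move=> x.
have sub_cont : {for x, continuous (fun y : R => 1 - y)}.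
  by apply: continuousB; [exact: cst_continuous|exact: cvg_id].
exact: (continuousM (@test_pow_continuous m x) sub_cont).
Qed.

(** The exponent is positive because [0 ^+ 0 = 1] would destroy the compact support. *)
Lemma test_pow_supp m : exists M : R, forall x, M < `|x| -> test_pow m.+1 x = 0.
Proof. by exists 2 => x /tent_out; rewrite /test_pow => ->; rewrite expr0n. Qed.

Lemma test_edge_supp m : exists M : R, forall x, M < `|x| -> test_edge m.+1 x = 0.
Proof. by exists 2 => x /tent_out; rewrite /test_edge => ->; rewrite expr0n mul0r. Qed.

Section Density.
Variables (a b : R).
Hypotheses (a01 : 0 < a < 1) (b01 : 0 < b < 1).

(** The inequality of arithmetic and geometric means bounds the two square roots by numbers that sum
    to 1. *)
Lemma r_plus_le1 : r_plus a b <= 1.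
Proof.
have [a0 a1] := andP a01; have [b0 b1] := andP b01.
have p0 : 0 <= a * (1 - b) by apply: mulr_ge0; lra.
have q0 : 0 <= b * (1 - a) by apply: mulr_ge0; lra.
rewrite /r_plus expr_le1 ?addr_ge0 ?sqrtr_ge0 //.
have := sqr_sqrtr p0; have := sqr_sqrtr q0.
have := sqrtr_ge0 (a * (1 - b)); have := sqrtr_ge0 (b * (1 - a)).
set u := Num.sqrt (a * (1 - b)); set v := Num.sqrt (b * (1 - a)) => v0 u0 v2 u2.
have : u <= (a + (1 - b)) / 2.
  rewrite -(@ler_pXn2r _ 2) // ?nnegrE //; last by lra.
  by rewrite u2; have := sqr_ge0 (a - (1 - b)); rewrite !expr2; lra.
have : v <= (b + (1 - a)) / 2.
  rewrite -(@ler_pXn2r _ 2) // ?nnegrE //; last by lra.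
  by rewrite v2; have := sqr_ge0 (b - (1 - a)); rewrite !expr2; lra.
lra.
Qed.

Lemma r_minus_lt_plus : r_minus a b < r_plus a b.
Proof.
have [a0 a1] := andP a01; have [b0 b1] := andP b01.
have p0 : 0 < Num.sqrt (a * (1 - b)) by rewrite sqrtr_gt0 mulr_gt0 //; lra.
have q0 : 0 < Num.sqrt (b * (1 - a)) by rewrite sqrtr_gt0 mulr_gt0 //; lra.
rewrite /r_minus /r_plus; nra.
Qed.

Lemma r_minus_ge0 : 0 <= r_minus a b. Proof. exact: sqr_ge0. Qed.

(** Only the atom at 1 is kept; the continuous part is nonnegative. *)
Lemma test_pow_manova m : a + b - 1 <= manova_int a b (test_pow m.+1).
Proof.
rewrite /manova_int /test_pow (@tent_id 0) ?lexx ?ler01 // (@tent_id 1) ?ler01 ?lexx //.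
rewrite expr0n mulr0 addr0 expr1n mulr1; apply: ler_wpDl; last by rewrite le_max lexx.
apply: Rintegral_ge0 => x /=; rewrite in_itv /= => /andP[lx xr].
have x0 : 0 <= x by apply: le_trans lx; exact: r_minus_ge0.
have x1 : x <= 1 by apply: le_trans r_plus_le1.
rewrite tent_id ?x0 //; apply: mulr_ge0; first exact: exprn_ge0.
apply: divr_ge0; first exact: sqrtr_ge0.
by rewrite !mulr_ge0 ?subr_ge0 // pi_ge0.
Qed.

(** The product of [test_edge m.+2] and the density on the support, with [x (1 - x)] cancelled; it
    is continuous on the whole line. *)
Let G m x := x ^+ m.+1 * (Num.sqrt ((r_plus a b - x) * (x - r_minus a b)) / (2 * pi)).

Lemma G_continuous m : continuous (G m).
Proof.
move=> x.
have c1 : {for x, continuous (fun y : R => r_plus a b - y)}.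
  by apply: continuousB; [exact: cst_continuous|exact: cvg_id].
have c2 : {for x, continuous (fun y : R => y - r_minus a b)}.
  by apply: continuousB; [exact: cvg_id|exact: cst_continuous].
have c3 : {for x, continuous (fun y : R => Num.sqrt ((r_plus a b - y) * (y - r_minus a b)))}.
  exact: (continuous_comp (continuousM c1 c2) (@sqrt_continuous R _)).
have c4 := continuousM c3 (@cst_continuous R R (2 * pi)^-1 x).
exact: (continuousM (@exprn_continuous R m.+1 x) c4).
Qed.

Lemma test_edge_manova_eq m : a + b <= 1 ->
  manova_int a b (test_edge m.+2) = Rintegral lebesgue_measure `[r_minus a b, r_plus a b] (G m).
Proof.
move=> ab; rewrite /manova_int /test_edge (@tent_id 0) ?lexx ?ler01 //.
rewrite expr0n mul0r mulr0 addr0 subrr !mulr0 addr0.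
apply: eq_Rintegral => x; rewrite inE /= in_itv /= => /andP[lx xr].
have x0 : 0 <= x by apply: le_trans lx; exact: r_minus_ge0.
have x1 : x <= 1 by apply: le_trans r_plus_le1.
rewrite tent_id ?x0 // /manova_density /G.
(* At 0 and 1 the density divides by zero, but both sides vanish there; at 1 this uses
   [r_plus a b = 1]. *)
have [->|xn0] := eqVneq x 0; first by rewrite !expr0n !mul0r.
have [x1E|xn1] := eqVneq x 1.
  have -> : r_plus a b = x by apply/eqP; rewrite eq_le xr x1E r_plus_le1.
  by rewrite x1E subrr mul0r sqrtr0 !mul0r !mulr0.
have pi0 : (pi : R) != 0 by rewrite gt_eqF // pi_gt0.
have x1' : 1 - x != 0 by rewrite subr_eq0 eq_sym.
rewrite exprS; move: (pi : R) pi0 => p p0; field; by rewrite ?xn0 ?x1' ?p0.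
Qed.

(** The integral is restricted to [[u, v]], with [v] halfway from [u] to the edge. There the power
    is at least [u ^+ m.+1] and the remaining factor at least [S], so [K = S (v - u)] is independent
    of [m]. *)
Lemma test_edge_manova_ge (u : R) : a + b <= 1 -> r_minus a b < u < r_plus a b ->
  exists2 K : R, 0 < K & forall m, K * u ^+ m.+1 <= manova_int a b (test_edge m.+2).
Proof.
move=> ab /andP[ru ur].
have u0 : 0 < u by apply: le_lt_trans ru; exact: r_minus_ge0.
pose v := (u + r_plus a b) / 2.
have uv : u < v by rewrite /v; lra.
have vr : v < r_plus a b by rewrite /v; lra.
pose S := Num.sqrt ((r_plus a b - v) * (u - r_minus a b)) / (2 * pi).
have S0 : 0 < S.
  rewrite divr_gt0 ?mulr_gt0 ?pi_gt0 // sqrtr_gt0 mulr_gt0 //; lra.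
exists (S * (v - u)) => [|m]; first by rewrite mulr_gt0 // subr_gt0.
rewrite test_edge_manova_eq //.
have G0 x : r_minus a b <= x <= r_plus a b -> 0 <= G m x.
  move=> /andP[lx xr]; have x0 : 0 <= x by apply: le_trans lx; exact: r_minus_ge0.
  by rewrite mulr_ge0 ?exprn_ge0 // divr_ge0 ?sqrtr_ge0 // mulr_ge0 // pi_ge0.
have sub_itv : `[u, v]%classic `<=` `[r_minus a b, r_plus a b]%classic.
  by move=> x /=; rewrite !in_itv /= => /andP[ux xv]; apply/andP; split; lra.
have Gint c d : lebesgue_measure.-integrable `[c, d]%classic (EFin \o G m).
  apply: continuous_compact_integrable; first exact: segment_compact.
  by apply: continuous_subspaceT; exact: G_continuous.
have -> : S * (v - u) * u ^+ m.+1 = Rintegral lebesgue_measure `[u, v]%classic (fun=> S * u ^+ m.+1).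
  have luv : lebesgue_measure `[u, v]%classic = (v - u)%:E.
    by rewrite lebesgue_measure_itv /= lte_fin uv.
  by rewrite Rintegral_cst //= [X in fine X]luv mulrAC.
apply: (@le_trans _ _ (Rintegral lebesgue_measure `[u, v]%classic (G m))).
  apply: le_Rintegral => //.
    apply: continuous_compact_integrable; first exact: segment_compact.
    by apply: continuous_subspaceT; exact: cst_continuous.
  move=> x /=; rewrite in_itv /= => /andP[ux xv]; rewrite mulrC; apply: ler_pM.
  - by rewrite exprn_ge0 // ltW.
  - exact: ltW.
  - by rewrite lerXn2r // nnegrE ltW // (lt_le_trans u0).
  rewrite ler_pM2r; last by rewrite invr_gt0 mulr_gt0 // pi_gt0.
  rewrite ler_sqrt; first by apply: ler_pM; lra.
  by apply: mulr_ge0; lra.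
rewrite /Rintegral fine_le //; [exact: integrable_fin_num|exact: integrable_fin_num|].
apply: ge0_subset_integral => //.
  by have /integrableP[] := Gint (r_minus a b) (r_plus a b).
Qed.

End Density.
End ManovaTestFunctions.

(** * Measurability *)

Section Measurability.
Local Open Scope sesquilinear_scope.
Variables (R : realType) (d : measure_display) (T : measurableType d).
Local Notation C := R[i].

(** Boundedness is carried along because, unlike integrability, it is stable under the products
    occurring in matrix powers. *)
Definition bounded_meas (X : T -> C) : Prop :=
  [/\ measurable_fun setT (fun w => complex.Re (X w)),
      measurable_fun setT (fun w => complex.Im (X w)) &
      exists K : R, forall w, `|complex.Re (X w)| <= K /\ `|complex.Im (X w)| <= K].

Lemma bounded_meas_cst z : bounded_meas (fun=> z).
Proof.
split; [exact: measurable_cst|exact: measurable_cst|].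
by exists (Num.max `|complex.Re z| `|complex.Im z|) => _; rewrite !le_max !lexx orbT.
Qed.

Lemma bounded_measD X Y :
  bounded_meas X -> bounded_meas Y -> bounded_meas (fun w => X w + Y w).
Proof.
move=> [mX1 mX2 [K XK]] [mY1 mY2 [H YH]]; split.
- rewrite (_ : (fun _ => _) = (fun w => complex.Re (X w)) \+ (fun w => complex.Re (Y w))).
    exact: measurable_funD.
  by apply/funext => w /=; rewrite raddfD.
- rewrite (_ : (fun _ => _) = (fun w => complex.Im (X w)) \+ (fun w => complex.Im (Y w))).
    exact: measurable_funD.
  by apply/funext => w /=; rewrite raddfD.
- exists (K + H) => w; have [XK1 XK2] := XK w; have [YH1 YH2] := YH w.
  by rewrite !raddfD /=; split; apply: le_trans (ler_normD _ _) _; apply: lerD.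
Qed.

Lemma bounded_measM X Y :
  bounded_meas X -> bounded_meas Y -> bounded_meas (fun w => X w * Y w).
Proof.
move=> [mX1 mX2 [K XK]] [mY1 mY2 [H YH]].
have ReM w : complex.Re (X w * Y w) =
    complex.Re (X w) * complex.Re (Y w) - complex.Im (X w) * complex.Im (Y w).
  by case: (X w) (Y w) => ? ? [].
have ImM w : complex.Im (X w * Y w) =
    complex.Re (X w) * complex.Im (Y w) + complex.Im (X w) * complex.Re (Y w).
  by case: (X w) (Y w) => ? ? [].
split.
- under eq_fun do rewrite ReM.
  by apply: measurable_funB; apply: measurable_funM.
- under eq_fun do rewrite ImM.
  by apply: measurable_funD; apply: measurable_funM.
- exists (K * H + K * H) => w; have [XK1 XK2] := XK w; have [YH1 YH2] := YH w.
  rewrite ReM ImM; split.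
    by apply: le_trans (ler_normB _ _) _; rewrite !normrM; apply: lerD; apply: ler_pM.
  by apply: le_trans (ler_normD _ _) _; rewrite !normrM; apply: lerD; apply: ler_pM.
Qed.

Lemma bounded_meas_sum (I : Type) (s : seq I) (X : I -> T -> C) :
  (forall i, bounded_meas (X i)) -> bounded_meas (fun w => \sum_(i <- s) X i w).
Proof.
move=> bX; elim: s => [|i s IH].
  by under eq_fun do rewrite big_nil; exact: bounded_meas_cst.
by under eq_fun do rewrite big_cons; exact: bounded_measD.
Qed.

Definition bounded_meas_mx n (F : T -> 'M[C]_n) : Prop :=
  forall p q, bounded_meas (fun w => F w p q).

Lemma bounded_meas_mxM n (F G : T -> 'M[C]_n) : bounded_meas_mx F ->
  bounded_meas_mx G -> bounded_meas_mx (fun w => F w *m G w).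
Proof.
move=> bF bG p q; under eq_fun do rewrite mxE.
by apply: bounded_meas_sum => j; exact: bounded_measM.
Qed.

Lemma bounded_meas_mxX n (F : T -> 'M[C]_n) m : bounded_meas_mx F ->
  bounded_meas_mx (fun w => F w ^+ m).
Proof.
move=> bF; elim: m => [|m IH]; first by move=> p q; exact: bounded_meas_cst.
by under eq_fun do rewrite exprS; exact: bounded_meas_mxM.
Qed.

Lemma bounded_meas_normalize n (F : T -> 'M[C]_n) c : bounded_meas_mx F ->
  bounded_meas_mx (fun w => normalize c (F w)).
Proof.
move=> bF p q; rewrite /normalize; under eq_fun do rewrite !mxE.
apply: bounded_measM; first exact: bounded_meas_cst.
by apply: bounded_measD => //; exact: bounded_meas_cst.
Qed.

Lemma bounded_meas_trace n (F : T -> 'M[C]_n) : bounded_meas_mx F ->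
  bounded_meas (fun w => \tr (F w)).
Proof. by move=> bF; apply: bounded_meas_sum => i; exact: bF. Qed.

(** Row [p] of [M] is the image of a unit vector under a contraction. *)
Lemma proj_entry_le1 n (M : 'M[C]_n) p q : M ^t* = M -> M *m M = M ->
  `|complex.Re (M p q)| <= 1 /\ `|complex.Im (M p q)| <= 1.
Proof.
move=> Mh M2; have := @proj_dot_le C n (delta_mx 0 p) M Mh M2.
rewrite -rowE !dotmxE !mxE (bigD1 q) //= [leRHS](bigD1 p) //= [X in _ <= _ + X]big1; last first.
  by move=> j jp; rewrite !mxE (negbTE jp) andbF mul0r.
rewrite !mxE !eqxx /= -!normCK normr1 expr1n addr0 => le1.
have {le1} : `|M p q| ^+ 2 <= 1.
  apply: le_trans le1; rewrite lerDl; apply: sumr_ge0 => j _.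
  by rewrite !mxE mul_conjC_ge0.
rewrite -add_Re2_Im2 -(rmorph1 (real_complex R)) lecR.
have := sqr_ge0 (complex.Re (M p q)); have := sqr_ge0 (complex.Im (M p q)).
move=> i2 r2 le1; split; rewrite -(@ler_pXn2r _ 2) ?nnegrE // expr1n real_normK ?num_real //; lra.
Qed.

Lemma bounded_meas_proj n (F : T -> 'M[C]_n) :
  (forall p q, measurable_fun setT (fun w => complex.Re (F w p q)) /\
     measurable_fun setT (fun w => complex.Im (F w p q))) ->
  (forall w, is_orth_proj (F w)) -> bounded_meas_mx F.
Proof.
move=> mF pF p q; have [m1 m2] := mF p q; split => //.
by exists 1 => w; have [Fh F2] := pF w; exact: proj_entry_le1.
Qed.

Section ABA.
Variables (n : nat) (A B : T -> 'M[C]_n).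
Hypotheses (bA : bounded_meas_mx A) (bB : bounded_meas_mx B).
Hypotheses (pA : forall w, is_orth_proj (A w)) (pB : forall w, is_orth_proj (B w)).
Let M w := A w *m B w *m A w.

Lemma measurable_trace_ABA m :
  measurable_fun setT (fun w => complex.Re (\tr (M w ^+ m))).
Proof.
suff [] : bounded_meas (fun w => \tr (M w ^+ m)) by [].
apply: bounded_meas_trace; apply: bounded_meas_mxX.
by apply: bounded_meas_mxM => //; exact: bounded_meas_mxM.
Qed.

(* For [c >= 0], [lambda_max M <= c] iff [tr (M ^+ m) <= n c ^+ m] for all [m]. *)
Lemma measurable_lambda_max : measurable_fun setT (fun w => lambda_max (M w)).
Proof.
move=> mD; apply: (measurability _ (RGenOInfty.measurableE R)) => //.
move=> /= _ [_ [c ->] <-]; rewrite setTI.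
have [c0|c0] := ltP c 0.
  rewrite (_ : _ @^-1` _ = setT) //; apply/seteqP; split=> // w _ /=.
  rewrite in_itv /= andbT; apply: lt_le_trans c0 _.
  have [[Ah A2] [Bh B2]] := (pA w, pB w).
  by have /andP[] := lambda_max_ABA_range Ah A2 Bh B2.
rewrite (_ : _ @^-1` _ = \bigcup_m
    ((fun w => complex.Re (\tr (M w ^+ m))) @^-1` `]n%:R * c ^+ m, +oo[%classic)).
  apply: bigcupT_measurable => m; rewrite -[X in measurable X]setTI.
  by apply: measurable_trace_ABA => //; exact: measurable_itv.
apply/seteqP; split=> w /=.
  rewrite in_itv /= andbT => cL; apply: contrapT => H.
  have [[Ah A2] [Bh B2]] := (pA w, pB w).
  suff : lambda_max (M w) <= c by rewrite leNgt cL.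
  apply/(lambda_max_ABA_leP Ah A2 Bh B2 c0) => m; rewrite leNgt; apply/negP => Hm.
  by apply: H; exists m => //=; rewrite in_itv /= andbT.
move=> [m _ /=]; rewrite !in_itv /= !andbT => Hm.
have [[Ah A2] [Bh B2]] := (pA w, pB w).
rewrite ltNge; apply/negP => /(lambda_max_ABA_leP Ah A2 Bh B2 c0)/(_ m).
by rewrite leNgt Hm.
Qed.

End ABA.
End Measurability.

(** * Tail bounds and convergence *)

Section TailBounds.
Local Open Scope sesquilinear_scope.
Variables (R : realType) (d : measure_display) (T : measurableType d).
Variable P : probability T R.
Local Notation C := R[i].
Variables (n : nat) (A B : T -> 'M[C]_n).
Hypotheses (bA : bounded_meas_mx A) (bB : bounded_meas_mx B).
Hypotheses (pA : forall w, is_orth_proj (A w)) (pB : forall w, is_orth_proj (B w)).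
Let M w := A w *m B w *m A w.
Let L w := lambda_max (M w).

Lemma measurable_lambda_ge c : measurable [set w | c <= L w].
Proof.
rewrite (_ : [set _ | _] = L @^-1` `[c, +oo[%classic); last first.
  by apply/seteqP; split=> w /=; rewrite in_itv /= andbT.
rewrite -[X in measurable X]setTI.
by apply: (measurable_lambda_max bA bB pA pB) => //; exact: measurable_itv.
Qed.

Lemma measurable_lambda_le c : measurable [set w | L w <= c].
Proof.
rewrite (_ : [set _ | _] = L @^-1` `]-oo, c]%classic); last first.
  by apply/seteqP; split=> w /=; rewrite in_itv /=.
rewrite -[X in measurable X]setTI.
by apply: (measurable_lambda_max bA bB pA pB) => //; exact: measurable_itv.
Qed.

Lemma bounded_Re_integrable (X : T -> C) : bounded_meas X ->
  P.-integrable setT (EFin \o (fun w => complex.Re (X w))).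
Proof.
move=> [mX _ [K XK]]; apply: measurable_bounded_integrable => //.
  by apply: le_lt_trans (probability_le1 P measurableT) _; rewrite ltry.
exists K; split; first exact: num_real.
by move=> x Kx w _ /=; have [XK1 _] := XK w; apply: le_trans XK1 (ltW Kx).
Qed.

(** Markov's argument: [rho * \1_E - n] is pointwise below the real part of the trace, by
    [trace_W_outlier] on [E] and [trace_W_even_ge] off [E], and the inequality is integrated. *)
Lemma upper_tail_bound (a b e : R) m : 0 < a < 1 -> 0 < b < 1 -> a + b <= 1 -> 0 < e ->
  (1 + e / (2 * (Num.sqrt (a * (1 - a)) * Num.sqrt (b * (1 - b))))) ^+ m.*2 *
    fine (P [set w | r_plus a b + e <= L w])
  <= n%:R + Normc.normc (cexpect P (fun w =>
       \tr ((normalize a (A w) *m normalize b (B w)) ^+ m.*2))).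
Proof.
move=> a01 b01 ab e0; set rho := _ ^+ m.*2; set E := [set w | _].
have mE : measurable E by exact: measurable_lambda_ge.
pose X w := \tr ((normalize a (A w) *m normalize b (B w)) ^+ m.*2).
have bX : bounded_meas X.
  apply: bounded_meas_trace; apply: bounded_meas_mxX; apply: bounded_meas_mxM;
  exact: bounded_meas_normalize.
have le_X w : rho * \1_E w - n%:R <= complex.Re (X w).
  have [[Ah A2] [Bh B2]] := (pA w, pB w).
  rewrite indicE; case: (boolP (w \in E)) => [|_]; last first.
    by rewrite mulr0 add0r; exact: trace_W_even_ge.
  by rewrite inE mulr1 => wE; exact: trace_W_outlier.
have iE : P.-integrable setT (EFin \o (\1_E : T -> R)) by exact: integrable_indic.
have irE : P.-integrable setT (EFin \o (fun w => rho * \1_E w)).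
  rewrite (_ : EFin \o _ = (fun w => rho%:E * (EFin \o (\1_E : T -> R)) w)%E) //.
  exact: integrableZl.
have icst : P.-integrable setT (EFin \o (fun _ : T => n%:R : R)).
  by apply: (@bounded_Re_integrable (fun=> n%:R%:C%C)); exact: bounded_meas_cst.
have int_le : rho * fine (P E) - n%:R <= Rintegral P setT (fun w => complex.Re (X w)).
  have -> : rho * fine (P E) - n%:R = Rintegral P setT (fun w => rho * \1_E w - n%:R).
    rewrite RintegralB // RintegralZl // Rintegral_cst //; congr (_ * _ - _).
      by rewrite /Rintegral integral_indic // setIT.
    have P1 : fine (P setT) = 1 by rewrite probability_setT.
    by rewrite [X in _ * X]P1 mulr1.
  apply: le_Rintegral => //; last exact: bounded_Re_integrable.
  rewrite (_ : EFin \o _ = ((fun w => (rho * \1_E w)%:E) \- (fun=> n%:R%:E))%E) //.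
  exact: integrableB.
rewrite -lerBlDl; apply: le_trans int_le _.
rewrite /cexpect -/X; set u := Rintegral _ _ _; set v := Rintegral _ _ _.
apply: le_trans (ler_norm _) _.
by have := normc_ge_Re (u +i* v)%C; rewrite lecR.
Qed.

Lemma esd_int_test_pow m w :
  esd_int (M w) (test_pow m) = n%:R^-1 * complex.Re (\tr (M w ^+ m)).
Proof.
have [[Ah A2] [Bh B2]] := (pA w, pB w).
rewrite /esd_int (Re_trace_ABA Ah A2 Bh B2); congr (_ * _).
rewrite big_seq [RHS]big_seq; apply: eq_bigr => z zM.
have [_ /andP[z0 zL]] := eigs_ABA Ah A2 Bh B2 zM.
have /andP[_ L1] := lambda_max_ABA_range Ah A2 Bh B2.
by rewrite /test_pow tent_id // z0 (le_trans zL).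
Qed.

Lemma esd_int_test_edge m w : esd_int (M w) (test_edge m) =
  esd_int (M w) (test_pow m) - esd_int (M w) (test_pow m.+1).
Proof.
rewrite /esd_int -mulrBr -sumrB; congr (_ * _).
have [[Ah A2] [Bh B2]] := (pA w, pB w).
rewrite big_seq [RHS]big_seq; apply: eq_bigr => z zM.
have [_ /andP[z0 zL]] := eigs_ABA Ah A2 Bh B2 zM.
have /andP[_ L1] := lambda_max_ABA_range Ah A2 Bh B2.
rewrite /test_pow /test_edge tent_id ?z0 ?(le_trans zL) //.
by rewrite exprSr mulrBr mulr1.
Qed.

Lemma measurable_esd_test_pow m :
  measurable_fun setT (fun w => esd_int (M w) (test_pow m)).
Proof.
under eq_fun do rewrite esd_int_test_pow.
by apply: measurable_funM => //; exact: measurable_trace_ABA.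
Qed.

Lemma measurable_esd_test_edge m :
  measurable_fun setT (fun w => esd_int (M w) (test_edge m)).
Proof.
under eq_fun do rewrite esd_int_test_edge.
by apply: measurable_funB; exact: measurable_esd_test_pow.
Qed.

Lemma esd_test_pow_range m w : (0 < n)%N -> 0 <= esd_int (M w) (test_pow m) <= L w ^+ m.
Proof.
move=> n0; have [[Ah A2] [Bh B2]] := (pA w, pB w).
have /andP[L0 _] := lambda_max_ABA_range Ah A2 Bh B2.
have nR : 0 < n%:R :> R by rewrite ltr0n.
rewrite esd_int_test_pow; apply/andP; split.
  rewrite mulr_ge0 ?invr_ge0 ?ler0n //.
  by apply: le_trans (trace_ABA_ge Ah A2 Bh B2 m n0); exact: exprn_ge0.
by rewrite mulrC ler_pdivrMr // mulrC; exact: trace_ABA_le.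
Qed.

(** On the event [L <= c] the spectral integral of [f] is at most [L ^+ m <= c ^+ m <= y - del], so
    it misses [y] by at least [del]. *)
Lemma lower_tail_bound (f : R -> R) m (c y del : R) : (0 < n)%N ->
  f = test_pow m \/ f = test_edge m -> 0 <= c -> c ^+ m + del <= y ->
  (P [set w | (L w <= c)%R] <= P [set w | (del <= `|esd_int (M w) f - y|)%R])%E.
Proof.
move=> n0 fE c0 cy.
have mf : measurable_fun setT (fun w => esd_int (M w) f).
  by case: fE => ->; [exact: measurable_esd_test_pow|exact: measurable_esd_test_edge].
have esd_le w : esd_int (M w) f <= L w ^+ m.
  case: fE => ->; first by have /andP[] := esd_test_pow_range m w n0.
  have /andP[_ le1] := esd_test_pow_range m w n0.
  have /andP[ge0 _] := esd_test_pow_range m.+1 w n0.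
  by rewrite esd_int_test_edge; lra.
apply: le_measure; rewrite ?inE.
- exact: measurable_lambda_le.
- rewrite (_ : [set _ | _] = (fun w => `|esd_int (M w) f - y|) @^-1` `[del, +oo[%classic); last first.
    by apply/seteqP; split=> w /=; rewrite in_itv /= andbT.
  rewrite -[X in measurable X]setTI.
  have mg : measurable_fun setT (fun w => `|esd_int (M w) f - y|).
    by apply: measurableT_comp => //; exact: measurable_funB.
  by apply: mg => //; exact: measurable_itv.
- move=> w /= Lc.
  have [[Ah A2] [Bh B2]] := (pA w, pB w).
  have /andP[L0 _] := lambda_max_ABA_range Ah A2 Bh B2.
  have : L w ^+ m <= c ^+ m by rewrite lerXn2r.
  by have := esd_le w; rewrite distrC => h1 h2; apply: le_trans (ler_norm _); lra.
Qed.

End TailBounds.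

(** * Elementary decay rates *)

Section Rates.
Variable R : realType.

Lemma expr_small (q del : R) : 0 <= q < 1 -> 0 < del -> exists m, q ^+ m.+1 < del.
Proof.
move=> /andP[q0 q1] del0.
have : (fun m => q ^+ m) @ \oo --> 0 by apply: cvg_expr; rewrite ger0_norm.
move=> /cvgr0_norm_lt/(_ _ del0)[m _ /(_ m.+1 (leqnSn m))] /=.
by rewrite ger0_norm ?exprn_ge0 // => ?; exists m.
Qed.

(* With [y = rho ^ (k / 4)], both [n] and [x] are at most [y]. *)
Lemma tail_rate (rho p n x : R) (k : nat) : 1 < rho -> 0 <= p <= 1 -> 1 <= n ->
  ln n <= ln rho / 4 * k%:R -> x <= expR (ln rho / 4 * k%:R) ->
  ((0 < k./2)%N -> rho ^+ k./2.*2 * p <= n + x) -> p * n <= 2 * rho.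
Proof.
move=> rho1 /andP[p0 p1] n1 len lex H; have rho0 : 0 < rho by lra.
set y := expR _ in lex.
have y4 : y ^+ 4 = rho ^+ k.
  rewrite /y -expRM_natl -[in RHS](lnK rho0) -expRM_natl.
  by congr expR; field.
have ny : n <= y by rewrite -[n]lnK ?posrE ?ler_expR //; lra.
have y1 : 1 <= y by apply: le_trans ny.
have yy4 : y ^+ 2 <= y ^+ 4 by rewrite ler_weXn2l.
have y14 : y <= y ^+ 4 by rewrite -{1}[y]expr1 ler_weXn2l.
(* Here [k <= 1], so [y ^+ 4 = rho ^+ k <= rho] already bounds [n]. *)
have [k0|k0] := posnP k./2.
  have : rho ^+ k <= rho.
    rewrite -{2}[rho]expr1 ler_weXn2l //; first exact: ltW.
    by case: k k0 {len lex y ny y1 yy4 y14 y4 H} => [|[|]].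
  by rewrite -y4; nra.
have {}H := H k0; set Q := rho ^+ k./2.*2 in H.
have Q0 : 0 < Q by exact: exprn_gt0.
(* Rounding [k] down to an even number costs at most a factor [rho]. The chain is then
   [Q p n <= 2 y^2 <= 2 y^4 <= 2 rho Q]. *)
have kQ : rho ^+ k <= rho * Q.
  rewrite -exprS ler_weXn2l //; first exact: ltW.
  by rewrite -{1}[k]odd_double_half -addn1 addnC leq_add2l; case: odd.
rewrite -(ler_pM2l Q0).
have H2 : Q * p * n <= (2 * y) * y.
  apply: ler_pM => //; [by rewrite mulr_ge0 // ltW|lra|lra].
rewrite -y4 in kQ; rewrite mulrA; apply: le_trans H2 _.
by rewrite -mulrA -expr2; nra.
Qed.

End Rates.

(** * Vanishing of the upper and lower tails *)

Section Convergence.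
Variables (R : realType) (d : measure_display) (T : nat -> measurableType d).
Variables (P : forall i, probability (T i) R) (N : nat -> nat).
Variables (A B : forall i, T i -> 'M[R[i]]_(N i)) (a b : R) (k : nat -> nat).
Hypothesis N_incr : forall i, (N i < N i.+1)%N.
Hypotheses (bA : forall i, bounded_meas_mx (@A i)) (bB : forall i, bounded_meas_mx (@B i)).
Hypotheses (pA : forall i w, is_orth_proj (@A i w)) (pB : forall i w, is_orth_proj (@B i w)).
Hypotheses (a01 : 0 < a < 1) (b01 : 0 < b < 1).
Let M i (w : T i) := A w *m B w *m A w.

Lemma N_ge i : (i <= N i)%N.
Proof. by elim: i => // i IH; apply: leq_ltn_trans IH (N_incr i). Qed.

Lemma upper_tail_cvg (eps : R) : 0 < eps -> a + b <= 1 ->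
  (forall e : R, 0 < e -> \forall i \near \oo, ln (N i)%:R <= e * (k i)%:R) ->
  (exists epsk : nat -> R, epsk @ \oo --> 0 /\
     forall i m, (1 <= m <= k i)%N ->
       Normc.normc (cexpect (P i) (fun w =>
          \tr ((normalize a (A w) *m normalize b (B w)) ^+ m)))
       <= expR (epsk i * (k i)%:R)) ->
  P i [set w | r_plus a b + eps <= lambda_max (M w)] @[i --> \oo] --> 0%E.
Proof.
move=> eps0 ab lnN [epsk [epsk0 tr_le]].
pose rho := 1 + eps / (2 * (Num.sqrt (a * (1 - a)) * Num.sqrt (b * (1 - b)))).
have rho1 : 1 < rho.
  by rewrite ltrDl divr_gt0 // !mulr_gt0 // sqrt_mul_compl_gt0.
have ln0 : 0 < ln rho / 4 by rewrite divr_gt0 // ln_gt0.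
(* The tail is at most [2 rho / N i], and [i + 1 <= 2 N i] for positive [i] turns this into
   [4 rho / (i + 1)]. *)
have r0 : (4 * rho * harmonic i)%:E @[i --> \oo] --> 0%E.
  apply: cvg_EFin; first by near=> i.
  rewrite -[X in _ --> X](mulr0 (4 * rho)).
  by apply: cvgM; [exact: cvg_cst|exact: cvg_harmonic].
apply: (squeeze_cvge _ (cvg_cst 0%E) r0).
near=> i; apply/andP; split; first exact: measure_ge0.
set E := [set w | _].
have mE : measurable E by exact: measurable_lambda_ge.
have i0 : (0 < i)%N by near: i; exact: nbhs_infty_gt.
have PE : P i E = (fine (P i E))%:E by rewrite fineK // fin_num_measure.
have p0 : 0 <= fine (P i E) by rewrite fine_ge0.
have p1 : fine (P i E) <= 1 by rewrite -lee_fin -PE probability_le1.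
have n1 : 1 <= (N i)%:R :> R by rewrite ler1n (leq_trans i0 (N_ge i)).
rewrite PE lee_fin.
have : fine (P i E) * (N i)%:R <= 2 * rho.
  apply: (@tail_rate _ rho _ _ (expR (epsk i * (k i)%:R)) (k i)) => //.
  - by rewrite p0.
  - by near: i; exact: lnN.
  - rewrite ler_expR ler_wpM2r //; apply: le_trans (ler_norm _) _.
    by near: i; exact: cvgr0_norm_le.
  (* The moment used is the even number [2 (k / 2)], which lies between 1 and [k] since [k / 2] is
     positive. *)
  - move=> k0; have := upper_tail_bound (P i) (@bA i) (@bB i) (@pA i) (@pB i) (k i)./2 a01 b01 ab eps0.
    move=> /le_trans; apply; rewrite lerD2l; apply: tr_le.
    by rewrite double_gt0 k0 -[leqRHS]odd_double_half leq_addl.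
have iN : i.+1%:R <= 2 * (N i)%:R :> R.
  rewrite -natrM ler_nat mul2n -addnn -addn1.
  by apply: leq_add; [exact: N_ge|exact: leq_trans i0 (N_ge i)].
rewrite /harmonic /= ler_pdivlMr ?ltr0n // => le2.
by nra.
Unshelve. all: end_near. Qed.

Lemma lower_tail_cvg (eps : R) : 0 < eps ->
  (forall f : R -> R, continuous f ->
     (exists K : R, forall x, K < `|x| -> f x = 0) ->
     cvg_in_prob P (fun i w => esd_int (M w) f) (manova_int a b f)) ->
  P i [set w | lambda_max (M w) <= edge a b - eps] @[i --> \oo] --> 0%E.
Proof.
move=> eps0 esd_cvg; set c := edge a b - eps.
have [c0|c0] := ltP c 0.
  rewrite (_ : (fun i => P i _) = (fun=> 0%E)); first exact: cvg_cst.
  apply/funext => i; rewrite (_ : [set _ | _] = set0) ?measure0 //.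
  apply/seteqP; split=> // w /= Lc.
  have [[Ah A2] [Bh B2]] := (@pA i w, @pB i w).
  have /andP[L0 _] := lambda_max_ABA_range Ah A2 Bh B2.
  by move: (le_lt_trans (le_trans L0 Lc) c0); rewrite ltxx.
(* A single test function suffices: one whose limiting integral exceeds [c ^+ m], the largest value
   possible when [lambda_max <= c]. *)
have [f [m [del [fE fc fs del0 cf]]]] : exists f m del,
    [/\ f = test_pow m \/ f = test_edge m, continuous f,
     exists K : R, forall x, K < `|x| -> f x = 0, 0 < del &
     c ^+ m + del <= manova_int a b f].
  move: c0; rewrite /c /edge; case: ifPn => [ab|]; last rewrite -leNgt => ab.
    (* The atom at 1 keeps all moments above [a + b - 1], while powers of [1 - eps] fall below half
       of it. *)
    move=> c0; have [||m cm] := @expr_small R (1 - eps) ((a + b - 1) / 2); [lra|lra|].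
    exists (test_pow m.+1), m.+1, ((a + b - 1) / 2); split.
    - by left.
    - exact: test_pow_continuous.
    - exact: test_pow_supp.
    - lra.
    - by apply: le_trans (test_pow_manova a01 b01 m); lra.
  move=> c0; have rr := r_minus_lt_plus a01 b01; have rp1 := r_plus_le1 a01 b01.
  set c1 := r_plus a b - eps in c0 *.
  have c1r : c1 < r_plus a b by rewrite /c1; lra.
  (* [u] lies inside the support and strictly above [c1], so [(c1 / u) ^+ m.+1] falls below [K / 2]
     for some [m]; the other half of [K] supplies [del]. *)
  pose u := (Num.max c1 (r_minus a b) + r_plus a b) / 2.
  have [cu ru] : c1 < u /\ r_minus a b < u.
    have cm : c1 <= Num.max c1 (r_minus a b) by rewrite le_max lexx.
    have rm : r_minus a b <= Num.max c1 (r_minus a b) by rewrite le_max lexx orbT.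
    by rewrite /u; lra.
  have ur : u < r_plus a b.
    by rewrite /u; have : Num.max c1 (r_minus a b) < r_plus a b; [rewrite gt_max c1r|lra].
  have u0 : 0 < u by exact: le_lt_trans cu.
  have [|K K0 HK] := @test_edge_manova_ge R a b a01 b01 u ab; first by rewrite ru.
  have [||m qm] := @expr_small R (c1 / u) (K / 2); [|lra|].
    by apply/andP; split; [rewrite divr_ge0 // ltW|rewrite ltr_pdivrMr // mul1r].
  have um : 0 < u ^+ m.+1 by exact: exprn_gt0.
  exists (test_edge m.+2), m.+2, (K / 2 * u ^+ m.+1); split.
  - by right.
  - exact: test_edge_continuous.
  - exact: test_edge_supp.
  - by rewrite mulr_gt0 //; lra.
  - apply: le_trans (HK m).
    have : c1 ^+ m.+1 <= K / 2 * u ^+ m.+1.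
      by rewrite -ler_pdivrMr // -expr_div_n ltW.
    have : c1 ^+ m.+2 <= c1 ^+ m.+1 by apply: ler_wiXn2l => //; lra.
    lra.
apply: (squeeze_cvge _ (cvg_cst 0%E) (esd_cvg f fc fs del del0)).
near=> i; apply/andP; split; first exact: measure_ge0.
apply: (lower_tail_bound (P i) (@bA i) (@bB i) (@pA i) (@pB i) _ fE c0 cf).
apply: leq_trans (N_ge i); near: i; exact: nbhs_infty_gt.
Unshelve. all: end_near. Qed.

End Convergence.

(** * From the two tails to convergence in probability *)

Unset Implicit Arguments.
Set Strict Implicit.
Set Printing Implicit Defensive.

Theorem theorem1p12 (R : realType) (d : measure_display)
  (T : nat -> measurableType d) (P : forall i, probability (T i) R)
  (N : nat -> nat) (A B : forall i, T i -> 'M[R[i]]_(N i))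
  (alpha beta : R) (k : nat -> nat) :
  (forall i, (N i < N i.+1)%N) ->
  (forall i (p q : 'I_(N i)),
     [/\ measurable_fun setT (fun w => complex.Re (A i w p q)),
         measurable_fun setT (fun w => complex.Im (A i w p q)),
         measurable_fun setT (fun w => complex.Re (B i w p q)) &
         measurable_fun setT (fun w => complex.Im (B i w p q))]) ->
  (forall i w, is_orth_proj (A i w) /\ is_orth_proj (B i w)) ->
  0 < alpha < 1 -> 0 < beta < 1 ->
  cvg_in_prob P (fun i w => complex.Re (\tr (A i w)) / (N i)%:R) alpha ->
  cvg_in_prob P (fun i w => complex.Re (\tr (B i w)) / (N i)%:R) beta ->
  (alpha = 2^-1 \/ beta = 2^-1) ->
  (forall f : R -> R, continuous f ->
     (exists M : R, forall x, M < `|x| -> f x = 0) ->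
     cvg_in_prob P (fun i w => esd_int (A i w *m B i w *m A i w) f)
       (manova_int alpha beta f)) ->
  (forall eps : R, 0 < eps ->
     \forall i \near \oo, ln (N i)%:R <= eps * (k i)%:R) ->
  (exists epsk : nat -> R, epsk @ \oo --> 0 /\
     forall i a, (1 <= a <= k i)%N ->
       Normc.normc (cexpect (P i) (fun w =>
          \tr ((normalize alpha (A i w) *m normalize beta (B i w)) ^+ a)))
       <= expR (epsk i * (k i)%:R)) ->
  (forall i w, lambda_max (A i w *m B i w *m A i w)
               = opnorm (A i w *m B i w) ^+ 2) /\
  cvg_in_prob P (fun i w => lambda_max (A i w *m B i w *m A i w))
    (edge alpha beta).
Proof.
move=> N_incr mAB projAB a01 b01 _ _ _ esd_cvg lnN tr_le; split.
  move=> i w; have [[Ah A2] [Bh B2]] := projAB i w.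
  exact: opnorm_AB Ah A2 Bh B2.
have pA i w : is_orth_proj (A i w) by have [] := projAB i w.
have pB i w : is_orth_proj (B i w) by have [] := projAB i w.
have bA i : bounded_meas_mx (@A i).
  by apply: bounded_meas_proj (pA i) => p q; have [] := mAB i p q.
have bB i : bounded_meas_mx (@B i).
  by apply: bounded_meas_proj (pB i) => p q; have [] := mAB i p q.
move=> eps eps0.
have lo := lower_tail_cvg N_incr bA bB pA pB a01 b01 eps0 esd_cvg.
have up : P i [set w | edge alpha beta + eps <= lambda_max (A i w *m B i w *m A i w)]
    @[i --> \oo] --> 0%E.
  (* When [alpha + beta > 1] the edge is 1, which [lambda_max] never exceeds, so the upper event is
     empty. *)
  rewrite /edge; case: ifPn => [ab|]; last first.
    rewrite -leNgt => ab; exact: (upper_tail_cvg N_incr bA bB pA pB a01 b01 eps0 ab lnN tr_le).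
  rewrite (_ : (fun i => P i _) = (fun=> 0%E)); first exact: cvg_cst.
  apply/funext => i; rewrite (_ : [set _ | _] = set0) ?measure0 //.
  apply/seteqP; split=> // w /= le1.
  have [[Ah A2] [Bh B2]] := projAB i w.
  by have /andP[_] := lambda_max_ABA_range Ah A2 Bh B2; lra.
have def0 : adde_def (0 : \bar R)%E 0%E by [].
have sum0 := cvgeD (FF := eventually_filter) def0 lo up; rewrite adde0 in sum0.
apply: (squeeze_cvge _ (cvg_cst 0%E) sum0).
apply: nearW => i; apply/andP; split; first exact: measure_ge0.
have mlo := measurable_lambda_le (bA i) (bB i) (pA i) (pB i) (edge alpha beta - eps).
have mup := measurable_lambda_ge (bA i) (bB i) (pA i) (pB i) (edge alpha beta + eps).
(* Union bound: a deviation of at least [eps] falls into one of the two tails. *)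
apply: le_trans (measureU2 _ mlo mup).
rewrite (_ : [set w | eps <= _] = [set w | lambda_max (A i w *m B i w *m A i w) <= edge alpha beta - eps]
   `|` [set w | edge alpha beta + eps <= lambda_max (A i w *m B i w *m A i w)]) //.
apply/seteqP; split=> w /=.
  by rewrite ler_normr => /orP[] ?; [right|left]; lra.
by rewrite ler_normr => -[] ?; apply/orP; [right|left]; lra.
Qed.
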